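(* For $s-q\ge1$, the spectral bound and the Hadamard bound for the Data-Fusion problem satisfy $$\mathfrak{z}_{\mathcal{S}}-\mathfrak{z}_{\mathcal{H}}\le\sum_{i=s-q+1}^{p}\log\left(\frac{d_i(I_p+GB^{-1}G^\top)}{\lambda_i(I_p+GB^{-1}G^\top)}\right).$$
   Context: Let $G\in\mathbb{R}^{p\times m}$, $H\in\mathbb{R}^{q\times m}$, $B:=H^\top H$ positive definite, $P:=\{1,\dots,p\}$, and $s$ an integer with $0<s-q<p$. The Data-Fusion problem is $\max\{\operatorname{ldet}(B+G^\top\operatorname{Diag}(x)G):\mathbf{e}^\top x=s-q,\ x\in\{0,1\}^p\}$, where $\operatorname{ldet}$ is log-determinant, $\mathbf{e}$ the all-ones vector, $\operatorname{Diag}(x)$ the diagonal matrix with diagonal $x$. For a symmetric matrix $X$, $d_i(X)$ is the $i$-th largest diagonal entry and $\lambda_i(X)$ the $i$-th largest eigenvalue. Spectral bound: $\mathfrak{z}_{\mathcal{S}}:=\operatorname{ldet}(B)+\sum_{i=1}^{s-q}\log\big(1+\lambda_i(GB^{-1}G^\top)\big)$. Hadamard bound: let $LL^\top$ be the Cholesky factorization of $B$, let $\rho_i(GL^{-\top}):=\|G_{i\cdot}L^{-\top}\|_2$ for $i\in P$ ($G_{i\cdot}$ is row $i$ of $G$), and let $\tau$ be a bijection from $\{1,\dots,p\}$ to $P$ such that $\rho_{\tau(i)}(GL^{-\top})\ge\rho_{\tau(j)}(GL^{-\top})$ whenever $i\le j$. Then $\mathfrak{z}_{\mathcal{H}}:=\operatorname{ldet}(B)+\sum_{i=1}^{s-q}\log\big(1+\rho_{\tau(i)}^2(GL^{-\top})\big)$.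 *)

(* Defs.v *)
From HB Require Import structures.
From mathcomp Require Import all_boot all_order all_algebra all_fingroup.
From mathcomp Require Import polyrcf.
From mathcomp Require Import reals exp.

Set Implicit Arguments.
Unset Strict Implicit.
Unset Printing Implicit Defensive.

Import Order.TTheory GRing.Theory Num.Theory.

Local Open Scope ring_scope.

Definition posdefmx (R : realType) (n : nat) (A : 'M[R]_n) : Prop :=
  A^T = A /\ forall v : 'cV[R]_n, v != 0 -> 0 < (v^T *m A *m v) 0 0.

Definition ldet (R : realType) (n : nat) (A : 'M[R]_n) : R := ln (\det A).

(* All real eigenvalues in nonincreasing order, each repeated according to its
   algebraic multiplicity; for a symmetric A this list has length n. *)
Definition eigvals (R : realType) (n : nat) (A : 'M[R]_n) : seq R :=
  sort >=%R
    (flatten [seq nseq (mup a (char_poly A)) a | a <- rootsR (char_poly A)]).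

Definition diag_entries (R : realType) (n : nat) (A : 'M[R]_n) : seq R :=
  sort >=%R [seq A i i | i : 'I_n].

(* Ranks start at 0: [eigval A i] and [diag_entry A i] are the (i+1)-st largest
   eigenvalue and diagonal entry. *)
Definition eigval (R : realType) (n : nat) (A : 'M[R]_n) (i : nat) : R :=
  (eigvals A)`_i.

Definition diag_entry (R : realType) (n : nat) (A : 'M[R]_n) (i : nat) : R :=
  (diag_entries A)`_i.

(* [is_trig_mx] means lower triangular. *)
Definition is_cholesky (R : realType) (n : nat) (A L : 'M[R]_n) : Prop :=
  [/\ is_trig_mx L, forall i, 0 < L i i & A = L *m L^T].

Definition norm2 (R : realType) (n : nat) (v : 'rV[R]_n) : R :=
  Num.sqrt (\sum_(j < n) v 0 j ^+ 2).

Definition rho (R : realType) (p m : nat) (A : 'M[R]_(p, m)) (i : 'I_p) : R :=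
  norm2 (row i A).

Definition spectral_bound (R : realType) (p q m : nat)
    (G : 'M[R]_(p, m)) (H : 'M[R]_(q, m)) (s : nat) : R :=
  let B := H^T *m H in
  ldet B + \sum_(i < s - q) ln (1 + eigval (G *m invmx B *m G^T) i).

(* [L] is meant to be the Cholesky factor of [H^T *m H], and [tau] to sort the
   rows of [G *m invmx L^T] by nonincreasing norm. *)
Definition hadamard_bound (R : realType) (p q m : nat)
    (G : 'M[R]_(p, m)) (H : 'M[R]_(q, m)) (s : nat)
    (L : 'M[R]_m) (tau : {perm 'I_p}) : R :=
  let B := H^T *m H in
  ldet B +
  \sum_(i < p | (i < s - q)%N) ln (1 + rho (G *m invmx L^T) (tau i) ^+ 2).

(* Main.v *)
Require Import Defs.
From HB Require Import structures.
From mathcomp Require Import all_boot all_order all_algebra all_fingroup.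
From mathcomp Require Import polyrcf complex.
From mathcomp Require Import reals exp.

Set Implicit Arguments.
Unset Strict Implicit.
Unset Printing Implicit Defensive.

Import Order.TTheory GRing.Theory Num.Theory.

Local Open Scope ring_scope.

(* With [A = I + G B^-1 G^T], we have [lambda_i A = 1 + lambda_i (G B^-1 G^T)],
   and since [G B^-1 G^T] is the Gram matrix of the rows of [G L^-T], also
   [d_i A = 1 + rho_(tau i) ^ 2].  Moving the tail sums to the other side turns
   the claim into [ln (\det A) <= sum_i ln (A i i)], which is Hadamard's
   inequality for the positive definite matrix [A]. *)

(** * Real spectrum and the characteristic polynomial *)

(* Over [R[i]] the roots exist and are real because [A] is Hermitian there. *)
Lemma sym_char_poly_split (R : rcfType) n (A : 'M[R]_n) :
  A^T = A -> exists s : seq R, char_poly A = \prod_(x <- s) ('X - x%:P).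
Proof.
move=> symA; pose toC := real_complex R.
have [r def_r] := closed_field_poly_normal (char_poly (map_mx toC A)).
rewrite (monicP (char_poly_monic _)) scale1r in def_r.
have r_real z : z \in r -> toC (complex.Re z) = z.
  rewrite -root_prod_XsubC -def_r -eigenvalue_root_char.
  case/eigenvalueP=> v vA vnz.
  have toCK (x : R) : Num.conj (toC x) = toC x by exact: conjc_real.
  pose w := (map_mx Num.conj v)^T.
  have Aw : map_mx toC A *m w = Num.conj z *: w.
    rewrite -[LHS]trmxK trmx_mul trmxK map_trmx symA.
    have <- : map_mx Num.conj (map_mx toC A) = map_mx toC A.
      by apply/matrixP=> i j; rewrite !mxE toCK.
    by rewrite -map_mxM vA map_mxZ linearZ.
  (* Here [w] is the conjugate transpose of the row eigenvector [v]. Both sides evaluate [v A w],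
     and [v *m w] is the squared norm of [v], so cancelling it leaves [z] equal to its conjugate. *)
  have : z *: (v *m w) = Num.conj z *: (v *m w).
    by rewrite scalemxAl -vA -mulmxA Aw scalemxAr.
  move/matrixP/(_ 0 0); rewrite mxE [RHS]mxE => /mulIf eq_z.
  have /eq_z : (v *m w) 0 0 != 0.
    apply: contra vnz; rewrite mxE psumr_eq0 => [/allP v0|j _]; last first.
      by rewrite !mxE mul_conjC_ge0.
    apply/eqP/rowP=> j; have := v0 j (mem_index_enum _).
    by rewrite !mxE mul_conjC_eq0 => /eqP.
  case: z {eq_z Aw vA} => a b [] /eqP.
  by rewrite -addr_eq0 -mulr2n mulrn_eq0 => /eqP ->.
exists (map (@complex.Re R) r); apply: (@map_poly_inj _ _ toC).
rewrite map_char_poly def_r map_prod_XsubC big_map.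
rewrite big_seq [RHS]big_seq; apply: eq_bigr => z zr.
by rewrite -[in LHS](r_real z).
Qed.

(** A value occurs in either list as often as its multiplicity as a root, so the lists are
    permutations of each other and sort to the same list. *)
Lemma eigvals_split (R : realType) n (A : 'M[R]_n) (s : seq R) :
  char_poly A = \prod_(x <- s) ('X - x%:P) -> eigvals A = sort >=%R s.
Proof.
move=> def_s; apply/perm_sortP.
- by move=> x y; exact: le_total.
- by move=> y x z /= yx zy; exact: le_trans yx.
- by move=> x y /= /andP[yx xy]; apply/eqP; rewrite eq_le xy yx.
apply/allP=> a _ /=; apply/eqP; rewrite count_flatten -map_comp sumnE big_map.
have -> : count_mem a s = mup a (char_poly A) by rewrite def_s mu_prod_XsubC.
have nz : char_poly A != 0 by rewrite monic_neq0 ?char_poly_monic.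
have := roots_on_rootsR nz a; rewrite in_itv /= => root_a.
under eq_bigr => b _ do rewrite /= count_nseq /=.
(* A root [a] is counted only by its own block of the flattened list; for a non-root both counts are
   zero. *)
have [ain|anin] := boolP (a \in rootsR (char_poly A)).
  rewrite (bigD1_seq a) //=; last first.
    by apply: (sorted_uniq lt_trans lt_irreflexive); exact: sorted_roots.
  rewrite eqxx mul1n big1 ?addn0 // => b /negbTE.
  by rewrite mulnC => ->; rewrite muln0.
rewrite big_seq big1 => [|b bin].
  apply/esym/eqP; rewrite -leqn0 -ltnS mup_ltn // expr1 dvdp_XsubCl.
  by rewrite root_a.
by rewrite (_ : (b == a) = false) //; apply: contraNF anin => /eqP <-.
Qed.

(** Substituting ['X - a%:P] is a ring morphism, hence commutes with the determinant. *)
Lemma char_poly_add_scalar (R : comNzRingType) n (a : R) (A : 'M[R]_n) :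
  char_poly (a%:M + A) = char_poly A \Po ('X - a%:P).
Proof.
rewrite /char_poly -det_map_mx; congr (\det _); apply/matrixP=> i j.
rewrite !mxE /= rmorphB /= comp_polyC rmorphMn /= comp_polyX rmorphD rmorphMn /=.
by rewrite mulrnBl opprD addrA.
Qed.

Lemma det_split (R : comNzRingType) n (A : 'M[R]_n) (s : seq R) :
  char_poly A = \prod_(x <- s) ('X - x%:P) -> \det A = \prod_(x <- s) x.
Proof.
move=> def_s; have size_s : size s = n.
  by have := size_char_poly A; rewrite def_s size_prod_XsubC => -[].
have := char_poly_det A; rewrite def_s coef0_prod_XsubC size_s.
by move/(can_inj (signrMK n)).
Qed.

Lemma trace_split (R : idomainType) n (A : 'M[R]_n) (s : seq R) :
  char_poly A = \prod_(x <- s) ('X - x%:P) -> \tr A = \sum_(x <- s) x.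
Proof.
move=> def_s; have size_s : size s = n.
  by have := size_char_poly A; rewrite def_s size_prod_XsubC => -[].
(* The trace is read off the second highest coefficient, which the empty matrix does not have. *)
case: n A def_s size_s => [|n] A def_s size_s.
  by move/size0nil: size_s => ->; rewrite big_nil /mxtrace big_ord0.
have := @coefPn_prod_XsubC _ s; rewrite size_s -def_s char_poly_trace //.
by move=> /(_ isT)/oppr_inj.
Qed.

(** * Positive definite matrices and Hadamard's inequality *)

Lemma posdefmx_eig_gt0 (R : realType) n (A : 'M[R]_n) (s : seq R) :
  posdefmx A -> char_poly A = \prod_(x <- s) ('X - x%:P) ->
  forall x, x \in s -> 0 < x.
Proof.
case=> _ posA def_s x; rewrite -root_prod_XsubC -def_s -eigenvalue_root_char.
(* For a row eigenvector [v], the quadratic form at [v^T] is [x] times the squared norm of [v]. *)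
case/eigenvalueP=> v vA vnz; have := posA v^T.
rewrite trmx_eq0 trmxK vA -scalemxAl mxE => /(_ vnz); rewrite pmulr_lgt0 //.
rewrite mxE lt_neqAle eq_sym sumr_ge0 => [|j _]; last first.
  by rewrite mxE -expr2 sqr_ge0.
rewrite andbT; apply: contra vnz; rewrite psumr_eq0 => [/allP v0|j _]; last first.
  by rewrite mxE -expr2 sqr_ge0.
apply/eqP/rowP=> j; have := v0 j (mem_index_enum _).
by rewrite !mxE -expr2 sqrf_eq0 => /eqP.
Qed.

Lemma posdefmx_diag_gt0 (R : realType) n (A : 'M[R]_n) i :
  posdefmx A -> 0 < A i i.
Proof.
case=> _ /(_ (delta_mx i 0)); rewrite trmx_delta -rowE -colE !mxE; apply.
by apply/negP=> /eqP/matrixP/(_ i 0)/eqP; rewrite !mxE !eqxx oner_eq0.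
Qed.

Lemma ln_prod (R : realType) (I : eqType) (r : seq I) (F : I -> R) :
  (forall i, i \in r -> 0 < F i) ->
  ln (\prod_(i <- r) F i) = \sum_(i <- r) ln (F i).
Proof.
move=> Fpos; rewrite !big_seq.
(* Positivity of the partial product is carried through the induction because [lnM] requires it. *)
suff [] : 0 < \prod_(i <- r | i \in r) F i /\
  ln (\prod_(i <- r | i \in r) F i) = \sum_(i <- r | i \in r) ln (F i) by [].
apply: (big_rec2 (fun x y => 0 < x /\ ln x = y)); first by rewrite ln1.
move=> i x y /Fpos Fi [x0 <-]; split; first exact: mulr_gt0.
by rewrite lnM ?posrE.
Qed.

(* After rescaling to unit diagonal, [ln x <= x - 1] at the eigenvalues gives
   [ln det <= trace - n = 0]. *)
Lemma hadamard (R : realType) n (A : 'M[R]_n) :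
  posdefmx A -> \det A <= \prod_i A i i.
Proof.
move=> posA; have dgt0 i := posdefmx_diag_gt0 i posA.
pose D := diag_mx (\row_i (Num.sqrt (A i i))^-1).
pose C := D *m A *m D.
have [symA posdA] := posA.
have C11 i : C i i = 1.
  rewrite /C mul_mx_diag mul_diag_mx !mxE mulrAC -expr2 exprVn sqr_sqrtr ?ltW //.
  by rewrite mulVf // gt_eqF.
have posC : posdefmx C.
  split=> [|v vnz]; first by rewrite /C !trmx_mul symA tr_diag_mx mulmxA.
  (* The form of [C] at [v] is that of [A] at [D *m v], which is nonzero because the diagonal of [D]
     is. *)
  rewrite (_ : v^T *m C *m v = (D *m v)^T *m A *m (D *m v)).
    apply: posdA; apply: contra vnz => /eqP Dv0; apply/eqP/colP=> i.
    have /eqP := congr1 (fun M : 'cV_n => M i 0) Dv0.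
    rewrite mul_diag_mx !mxE mulf_eq0 invr_eq0 sqrtr_eq0 leNgt dgt0 /=.
    by move/eqP.
  by rewrite /C trmx_mul tr_diag_mx !mulmxA.
have [s def_s] := sym_char_poly_split posC.1.
have s_gt0 := posdefmx_eig_gt0 posC def_s.
have detC : \det C = \det A / \prod_i A i i.
  rewrite /C !det_mulmx det_diag mulrAC mulrC; congr (_ * _).
  rewrite -big_split -prodfV /=; apply: eq_bigr => i _.
  by rewrite mxE -invfM -expr2 sqr_sqrtr ?ltW.
have prod_gt0 : 0 < \prod_i A i i by apply: prodr_gt0.
suff : \det C <= 1 by rewrite detC ler_pdivrMr // mul1r.
have detC_gt0 : 0 < \det C.
  by rewrite (det_split def_s) big_seq; apply: prodr_gt0.
rewrite -ler_ln ?posrE // ln1 (det_split def_s) ln_prod //.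
have size_s : size s = n.
  by have := size_char_poly C; rewrite def_s size_prod_XsubC => -[].
have trC : \sum_(x <- s) (x - 1) = 0.
  rewrite sumrB -(trace_split def_s) big_const_seq count_predT size_s iter_addr_0.
  by rewrite /mxtrace (eq_bigr (fun=> 1)) // sumr_const card_ord subrr.
(* With 0 written as the sum of [x - 1] over the eigenvalues, the bound holds term by term. *)
rewrite -[leRHS]trC !big_seq; apply: ler_sum => x /s_gt0 x0.
have := @le_ln1Dx R (x - 1); rewrite addrCA subrr addr0; apply.
by rewrite ltrBrDr addNr.
Qed.

(** * Ordered diagonal entries, Gram matrices and shifted eigenvalues *)

Lemma sorted_diag_entry (R : realType) p (A : 'M[R]_p) (tau : {perm 'I_p}) :
  (forall i j : 'I_p, (i <= j)%N -> A (tau j) (tau j) <= A (tau i) (tau i)) ->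
  forall i : 'I_p, diag_entry A i = A (tau i) (tau i).
Proof.
move=> tauP i; have trR : transitive (>=%R : rel R).
  by move=> y x z /= yx zy; exact: le_trans yx.
(* Read in the order [tau], the diagonal is a permutation of itself that is already nonincreasing,
   so it is the sorted list, whatever the ties. *)
have -> : diag_entry A i = [seq A (tau j) (tau j) | j <- enum 'I_p]`_i.
  congr (_`_i); rewrite /diag_entries -[RHS](sorted_sort trR).
    apply/perm_sortP => //.
    - by move=> x y; exact: le_total.
    - by move=> x y /= /andP[yx xy]; apply/eqP; rewrite eq_le xy yx.
    rewrite (map_comp (fun j => A j j) tau); apply: perm_map.
    apply: uniq_perm => [||j]; first exact: enum_uniq.
      by rewrite map_inj_uniq ?enum_uniq //; exact: perm_inj.
    rewrite mem_enum; apply/esym/mapP.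
    by exists (tau^-1%g j); rewrite ?mem_enum ?permKV.
  rewrite sorted_map; apply: (sub_sorted (e := relpre val leq)).
    by move=> j k /= /tauP.
  by rewrite -sorted_map val_enum_ord iota_sorted.
by rewrite (nth_map i) ?size_enum_ord // nth_ord_enum.
Qed.

(** The positive diagonal makes the triangular [L] invertible, so [B] has inverse
    [invmx L^T *m invmx L], whose factors are transposes of each other. *)
Lemma gram_cholesky (R : realType) p m (G : 'M[R]_(p, m)) (B L : 'M[R]_m) :
  is_cholesky B L ->
  G *m invmx B *m G^T = (G *m invmx L^T) *m (G *m invmx L^T)^T.
Proof.
case=> trL Lpos ->.
have uL : L \in unitmx.
  by rewrite unitmxE det_trig // unitfE gt_eqF // prodr_gt0.
have uLT : L^T \in unitmx by rewrite unitmx_tr.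
have -> : invmx (L *m L^T) = invmx L^T *m invmx L.
  have uLL : L *m L^T \in unitmx by rewrite unitmx_mul uL.
  rewrite -[RHS](mulKmx uLL) -mulmxA [L^T *m _]mulmxA mulmxV // mul1mx.
  by rewrite mulmxV // mulmx1.
by rewrite trmx_mul trmx_inv trmxK !mulmxA.
Qed.

(** The quadratic form at [v] is the squared norm of [v] plus that of [v^T *m M]. *)
Lemma posdefmx_addI_gram (R : realType) p m (M : 'M[R]_(p, m)) :
  posdefmx (1%:M + M *m M^T).
Proof.
have gram_ge0 n (u : 'rV[R]_n) : 0 <= (u *m u^T) 0 0.
  by rewrite mxE sumr_ge0 // => j _; rewrite mxE -expr2 sqr_ge0.
split=> [|v vnz]; first by rewrite linearD /= trmx1 trmx_mul trmxK.
rewrite mulmxDr mulmx1 mulmxDl mxE ltr_wpDr //.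
  rewrite (_ : _ *m v = (v^T *m M) *m (v^T *m M)^T) //.
  by rewrite trmx_mul trmxK !mulmxA.
have := gram_ge0 _ v^T; rewrite trmxK le_eqVlt => /orP[/eqP/esym/eqP|//].
rewrite mxE psumr_eq0 => [/allP v0|j _]; last by rewrite mxE -expr2 sqr_ge0.
case/eqP: vnz; apply/colP=> j; have := v0 j (mem_index_enum _).
by rewrite !mxE -expr2 sqrf_eq0 => /eqP.
Qed.

Lemma rho_sqr (R : realType) p m (M : 'M[R]_(p, m)) i :
  rho M i ^+ 2 = (M *m M^T) i i.
Proof.
rewrite /rho /norm2 sqr_sqrtr ?sumr_ge0 // => [|j _]; last by rewrite sqr_ge0.
by rewrite mxE; apply: eq_bigr => j _; rewrite !mxE expr2.
Qed.

(** Adding the identity shifts every root by 1, and an increasing shift commutes with sorting. Rank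
    [i] must stay below [p]: past the end of the lists [eigval] defaults to 0 on both sides. *)
Lemma eigval_addI (R : realType) p (C : 'M[R]_p) i :
  C^T = C -> (i < p)%N -> eigval (1%:M + C) i = 1 + eigval C i.
Proof.
move=> symC ltip; have [s def_s] := sym_char_poly_split symC.
have size_s : size s = p.
  by have := size_char_poly C; rewrite def_s size_prod_XsubC => -[].
have def_t : char_poly (1%:M + C) = \prod_(x <- map (+%R 1) s) ('X - x%:P).
  rewrite char_poly_add_scalar def_s rmorph_prod big_map; apply: eq_bigr => x _.
  by rewrite /= rmorphB /= comp_polyX comp_polyC polyCD opprD addrA.
rewrite /eigval (eigvals_split def_s) (eigvals_split def_t).
rewrite (homo_sort_map (leT := >=%R)) => [||||x y]; last by rewrite /= lerD2l.
- by rewrite (nth_map 0) ?size_sort ?size_s.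
- move=> x y /= /andP[]; rewrite !lerD2l => yx xy.
  by apply/eqP; rewrite eq_le xy yx.
- by move=> y x z /=; rewrite !lerD2l => yx zy; exact: le_trans yx.
- by move=> x y; exact: le_total.
Qed.

(** * Comparison of the two bounds *)

Theorem theorem20 (R : realType) (p q m s : nat)
    (G : 'M[R]_(p, m)) (H : 'M[R]_(q, m))
    (L : 'M[R]_m) (tau : {perm 'I_p}) :
  posdefmx (H^T *m H) ->
  (0 < s - q < p)%N ->
  is_cholesky (H^T *m H) L ->
  (forall i j : 'I_p, (i <= j)%N ->
     rho (G *m invmx L^T) (tau j) <= rho (G *m invmx L^T) (tau i)) ->
  spectral_bound G H s - hadamard_bound G H s L tau <=
  \sum_(s - q <= i < p)
     ln (diag_entry (1%:M + G *m invmx (H^T *m H) *m G^T) i /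
         eigval (1%:M + G *m invmx (H^T *m H) *m G^T) i).
Proof.
move=> _ /andP[_ ltkp] cholL tauP.
rewrite /spectral_bound /hadamard_bound /= (gram_cholesky G cholL).
move: (s - q)%N ltkp => k ltkp; set M := G *m invmx L^T in tauP *.
(* The common term [ldet (H^T *m H)] cancels. *)
set A := 1%:M + _; rewrite opprD addrACA subrr add0r.
have posA : posdefmx A by exact: posdefmx_addI_gram.
have A_diag i : A i i = 1 + rho M i ^+ 2 by rewrite rho_sqr /A mxE mxE eqxx.
have dE (i : 'I_p) : diag_entry A i = A (tau i) (tau i).
  (* Norms are nonnegative, so [tau] orders their squares in the same way. *)
  apply: sorted_diag_entry => {}i j /tauP; rewrite !A_diag lerD2l.
  by rewrite ler_sqr ?nnegrE ?sqrtr_ge0.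
have [t def_t] := sym_char_poly_split posA.1.
have size_t : size t = p.
  by have := size_char_poly A; rewrite def_t size_prod_XsubC => -[].
have eE : eigvals A = sort >=%R t := eigvals_split def_t.
have t_gt0 := posdefmx_eig_gt0 posA def_t.
have e_gt0 i : (i < p)%N -> 0 < eigval A i.
  move=> ltip; apply: t_gt0; rewrite /eigval eE -(mem_sort >=%R).
  by rewrite mem_nth // size_sort size_t.
have d_gt0 i : (i < p)%N -> 0 < diag_entry A i.
  by move=> ltip; rewrite (dE (Ordinal ltip)) posdefmx_diag_gt0.
(* Hadamard's inequality for [A] in logarithms, over all ranks. *)
have main : \sum_(0 <= i < p) ln (eigval A i) <=
            \sum_(0 <= i < p) ln (diag_entry A i).
  have -> : \sum_(0 <= i < p) ln (eigval A i) = ln (\det A).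
    have size_e : size (eigvals A) = p by rewrite eE size_sort.
    rewrite (det_split def_t) ln_prod //.
    have perm_t: perm_eq (eigvals A) t by rewrite eE perm_sort.
    by rewrite -(perm_big _ perm_t) [RHS](big_nth 0) size_e.
  have -> : \sum_(0 <= i < p) ln (diag_entry A i) = ln (\prod_i A i i).
    rewrite ln_prod => [|i _]; last exact: posdefmx_diag_gt0.
    rewrite big_mkord [RHS](reindex_inj (@perm_inj _ tau)) /=.
    by apply: eq_bigr => i _; rewrite dE.
  rewrite ler_ln ?posrE ?hadamard //.
    by rewrite (det_split def_t) big_seq; apply: prodr_gt0.
  by apply: prodr_gt0 => i _; apply: posdefmx_diag_gt0.
have -> : \sum_(i < k) ln (1 + eigval (M *m M^T) i) =
          \sum_(0 <= i < k) ln (eigval A i).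
  rewrite big_mkord; apply: eq_bigr => i _; rewrite eigval_addI //.
    by rewrite trmx_mul trmxK.
  exact: ltn_trans ltkp.
have -> : \sum_(i < p | (i < k)%N) ln (1 + rho M (tau i) ^+ 2) =
          \sum_(0 <= i < k) ln (diag_entry A i).
  rewrite big_mkord (big_ord_widen p (fun i => ln (diag_entry A i)) (ltnW ltkp)).
  by apply: eq_bigr => i _; rewrite dE A_diag.
have -> : \sum_(k <= i < p) ln (diag_entry A i / eigval A i) =
  \sum_(k <= i < p) ln (diag_entry A i) - \sum_(k <= i < p) ln (eigval A i).
  rewrite -sumrB !big_nat; apply: eq_bigr => i /andP[_ ltip].
  by rewrite ln_div ?posrE ?e_gt0 ?d_gt0.
(* Splitting both full sums at rank [k] and moving the heads to one side and the tails to the other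
   gives the claim. *)
move: main; rewrite !(big_cat_nat (leq0n k) (ltnW ltkp)) /=.
by rewrite lerBlDr addrAC lerBrDr [X in _ <= X]addrC.
Qed.
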